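(* Consider the nonlinear system $x_{k+1}=f(x_k,u_k)$, $y_k=g(x_k,u_k)$ with a Koopman linear embedding $z_{k+1}=Az_k+Bu_k$, $y_k=Cz_k+Du_k$, $z_k=\Phi(x_k)\in\mathbb{R}^{n_z}$. Collect a data library $$H_d=\begin{bmatrix}U_d\\ Y_d\end{bmatrix}:=\begin{bmatrix}u_d^1&u_d^2&\cdots&u_d^l\\ y_d^1&y_d^2&\cdots&y_d^l\end{bmatrix}\in\mathbb{R}^{(m+p)L\times l}$$ of $l\ge mL+n_z$ trajectories $\mathrm{col}(u_d^i,y_d^i)\in\mathcal{B}_1|_L$ of the nonlinear system, whose length is $L=T_{\mathrm{ini}}+N$ with $T_{\mathrm{ini}}\ge n_z$. Suppose these $l$ trajectories provide lifted excitation of order $L$. Partition $U_d=\mathrm{col}(U_P,U_F)$ and $Y_d=\mathrm{col}(Y_P,Y_F)$, where $U_P$ and $Y_P$ consist of the first $T_{\mathrm{ini}}$ block rows (time steps) and $U_F$ and $Y_F$ of the last $N$ block rows of $U_d$ and $Y_d$, respectively. At time $k$, let $\mathrm{col}(u_{\mathrm{ini}},y_{\mathrm{ini}})$ be the most recent input-output sequence of length $T_{\mathrm{ini}}$ generated by the nonlinear system, $$u_{\mathrm{ini}}=\mathrm{col}(u_{k-T_{\mathrm{ini}}},\dots,u_{k-1}),\qquad y_{\mathrm{ini}}=\mathrm{col}(y_{k-T_{\mathrm{ini}}},\dots,y_{k-1}).$$ Then, for any future input $u_F=\mathrm{col}(u_k,\dots,u_{k+N-1})\in\mathbb{R}^{mN}$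 (and any $y_F\in\mathbb{R}^{pN}$), the sequence $\mathrm{col}(u_{\mathrm{ini}},y_{\mathrm{ini}},u_F,y_F)$ is a valid length-$L$ trajectory of the nonlinear system (i.e., with $u=\mathrm{col}(u_{\mathrm{ini}},u_F)$ and $y=\mathrm{col}(y_{\mathrm{ini}},y_F)$ one has $\mathrm{col}(u,y)\in\mathcal{B}_1|_L$) if and only if there exists $g\in\mathbb{R}^l$ such that $$\mathrm{col}(U_P,Y_P,U_F,Y_F)\,g=\mathrm{col}(u_{\mathrm{ini}},y_{\mathrm{ini}},u_F,y_F).$$
   Context: Nonlinear system: $f:\mathbb{R}^n\times\mathbb{R}^m\to\mathbb{R}^n$, $g:\mathbb{R}^n\times\mathbb{R}^m\to\mathbb{R}^p$ are given; $x_k\in\mathbb{R}^n$, $u_k\in\mathbb{R}^m$, $y_k\in\mathbb{R}^p$ are state, input and output at time $k$. (The vector $g\in\mathbb{R}^l$ in the claim is unrelated to the output map $g$.) Since $\mathrm{col}(u_{\mathrm{ini}},y_{\mathrm{ini}})$ is generated by the system, it belongs to $\mathcal{B}_1|_{T_{\mathrm{ini}}}$. Koopman linear embedding: the nonlinear system admits a Koopman linear embedding if there exist linearly independent lifting functions $\phi_1,\dots,\phi_{n_z}:\mathbb{R}^n\to\mathbb{R}$ such that $\Phi(x):=\mathrm{col}(\phi_1(x),\dots,\phi_{n_z}(x))\in\mathbb{R}^{n_z}$ propagates linearly along all trajectories of the system and the output is a linear map of $\Phi(x_k)$ and $u_k$; that is, there are real matrices $A\in\mathbb{R}^{n_z\times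 n_z}$, $B\in\mathbb{R}^{n_z\times m}$, $C\in\mathbb{R}^{p\times n_z}$, $D\in\mathbb{R}^{p\times m}$ with $\Phi(f(x,u))=A\Phi(x)+Bu$ and $g(x,u)=C\Phi(x)+Du$ for all $x\in\mathbb{R}^n$, $u\in\mathbb{R}^m$. The embedding need not be controllable or observable. Notation: $\mathrm{col}$ denotes vertical stacking (of vectors or of matrices with the same number of columns). $\mathcal{B}_1|_L$ is the set of $\mathrm{col}(u,y)\in\mathbb{R}^{(m+p)L}$, with $u=\mathrm{col}(u_0,\dots,u_{L-1})$, $y=\mathrm{col}(y_0,\dots,y_{L-1})$, for which there exists an initial state $x_0\in\mathbb{R}^n$ such that the nonlinear system equations hold along the sequence. Lifted excitation: $l\ge mL+n_z$ trajectories $\mathrm{col}(u_d^i,y_d^i)\in\mathcal{B}_1|_L$, $i=1,\dots,l$, with initial states $x_0^i\in\mathbb{R}^n$ (so that $\mathrm{col}(u_d^i,y_d^i)$ is generated by the nonlinear system from $x_0^i$), provide lifted excitation of order $L$ if the matrix $$H_K:=\begin{bmatrix}u_d^1&u_d^2&\cdots&u_d^l\\ \Phi(x_0^1)&\Phi(x_0^2)&\cdots&\Phi(x_0^l)\end{bmatrix}\in\mathbb{R}^{(mL+n_z)\times l}$$ has full row rank. *)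

(* Defs.v *)
From mathcomp Require Import all_boot all_order all_algebra.
From mathcomp Require Import reals.

Set Implicit Arguments.
Unset Strict Implicit.
Unset Printing Implicit Defensive.

Import GRing.Theory.
Local Open Scope ring_scope.

(* A signal of length L in R^d, stacked as col(v_0, ..., v_(L-1)), is a column *)
(* (more generally, a matrix) with \sum_(t < L) d rows: this is the type of    *)
(* \mxcol_(t < L) v t, and [submxcol v t] is its value at time t.              *)

Section Stacking.
Variable R : realType.

Definition columns (r l : nat) (v : 'I_l -> 'cV[R]_r) : 'M[R]_(r, l) :=
  \matrix_(i < r, j < l) v j i ord0.

Definition past (d l T N : nat) (M : 'M[R]_(\sum_(t < T + N) d, l)) :
    'M[R]_(\sum_(t < T) d, l) :=
  \mxcol_(t < T) submxcol M (lshift N t).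

Definition future (d l T N : nat) (M : 'M[R]_(\sum_(t < T + N) d, l)) :
    'M[R]_(\sum_(t < N) d, l) :=
  \mxcol_(t < N) submxcol M (rshift T t).

Definition concat (d T N : nat) (v : 'cV[R]_(\sum_(t < T) d))
    (w : 'cV[R]_(\sum_(t < N) d)) : 'cV[R]_(\sum_(t < T + N) d) :=
  \mxcol_(t < T + N)
    match split t with inl i => submxcol v i | inr j => submxcol w j end.

End Stacking.

Section System.
Variables (R : realType) (n m p : nat).
Variables (f : 'cV[R]_n -> 'cV[R]_m -> 'cV[R]_n).
Variables (g : 'cV[R]_n -> 'cV[R]_m -> 'cV[R]_p).

Definition generated_from (L : nat) (x0 : 'cV[R]_n)
    (u : 'cV[R]_(\sum_(t < L) m)) (y : 'cV[R]_(\sum_(t < L) p)) : Prop :=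
  exists x : nat -> 'cV[R]_n,
    x 0%N = x0 /\
    forall t : 'I_L, x t.+1 = f (x t) (submxcol u t) /\
                     submxcol y t = g (x t) (submxcol u t).

(* The restricted behaviour B_1|_L, as a predicate on vectors col(u, y).       *)
Definition behaviour (L : nat)
    (w : 'cV[R]_(\sum_(t < L) m + \sum_(t < L) p)) : Prop :=
  exists x0 : 'cV[R]_n, generated_from x0 (usubmx w) (dsubmx w).

Section Koopman.
Variables (nz : nat) (phi : 'I_nz -> 'cV[R]_n -> R).

Definition lin_indep_funs : Prop :=
  forall c : 'I_nz -> R,
    (forall x, \sum_(i < nz) c i * phi i x = 0) -> forall i, c i = 0.

Definition lift_map (x : 'cV[R]_n) : 'cV[R]_nz := \col_(i < nz) phi i x.

Definition koopman_embedding (A : 'M[R]_nz) (B : 'M[R]_(nz, m))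
    (C : 'M[R]_(p, nz)) (D : 'M[R]_(p, m)) : Prop :=
  [/\ lin_indep_funs,
      forall x u, lift_map (f x u) = A *m lift_map x + B *m u
    & forall x u, g x u = C *m lift_map x + D *m u].

(* [row_free] is full row rank.  The initial states are arguments because a    *)
(* pair (u, y) alone need not determine them.                                  *)
Definition lifted_excitation (L l : nat) (x0 : 'I_l -> 'cV[R]_n)
    (u : 'I_l -> 'cV[R]_(\sum_(t < L) m))
    (y : 'I_l -> 'cV[R]_(\sum_(t < L) p)) : Prop :=
  (forall i, generated_from (x0 i) (u i) (y i)) /\
  row_free (col_mx (columns u) (columns (fun i => lift_map (x0 i)))).

End Koopman.
End System.

(* Main.v *)
Require Import Defs.
From mathcomp Require Import all_boot all_order all_algebra.
From mathcomp Require Import reals.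

Set Implicit Arguments.
Unset Strict Implicit.
Unset Printing Implicit Defensive.

Import GRing.Theory.
Local Open Scope ring_scope.

(** Write xs for the state of the measured trajectory at time k - Tini.  The
    lifted initial state and the input determine the output linearly, so the
    embedding turns both sides into statements about the linear system
    (A, B, C, D), whose trajectories form a vector space.

    If the completed sequence is a trajectory from some state x', full row rank
    of the excitation matrix gives coefficients alpha that combine the recorded
    inputs to the input of the sequence and the recorded lifted states to
    Phi x'.  By superposition ([linear_generated_columns]) alpha also combines
    the recorded outputs to an output of the linear system from Phi x' under
    that input, and outputs are unique.

    Conversely, a combination alpha of the data is a trajectory of the linear
    system from z0 = sum_i alpha_i Phi (x0 i), and z0 need not be the lift of
    any state.  It is compared with the true trajectory that starts at xs and
    has the same input: the two outputs agree on the first Tini >= nz steps, and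
    by Cayley-Hamilton two linear trajectories with equal inputs and equal first
    nz outputs have equal outputs forever ([linear_output_determined]).  Hence
    the candidate output is the output of the nonlinear system from xs. *)

(** * Past and future parts of stacked signals *)

Section Stacking.
Variable R : realType.

Lemma columns_mul r l (v : 'I_l -> 'cV[R]_r) (a : 'cV[R]_l) :
  columns v *m a = \sum_(i < l) a i ord0 *: v i.
Proof.
apply/colP => j; rewrite mxE summxE; apply: eq_bigr => i _.
by rewrite !mxE mulrC.
Qed.

Lemma submxcolZ d L l a (M : 'M[R]_(\sum_(t < L) d, l)) t :
  submxcol (a *: M) t = a *: submxcol M t.
Proof. by apply/matrixP => i j; rewrite !mxE. Qed.

Variables d T N : nat.

Lemma past_mul l l' (M : 'M[R]_(\sum_(t < T + N) d, l)) (a : 'M[R]_(l, l')) :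
  past M *m a = past (M *m a).
Proof. by apply/mxcolP => t; rewrite -submxcol_mul !mxcolK submxcol_mul. Qed.

Lemma future_mul l l' (M : 'M[R]_(\sum_(t < T + N) d, l)) (a : 'M[R]_(l, l')) :
  future M *m a = future (M *m a).
Proof. by apply/mxcolP => t; rewrite -submxcol_mul !mxcolK submxcol_mul. Qed.

Lemma past_concat (v : 'cV[R]_(\sum_(t < T) d)) (w : 'cV[R]_(\sum_(t < N) d)) :
  past (concat v w) = v.
Proof.
by apply/mxcolP => t; rewrite !mxcolK -[lshift N t]/(unsplit (inl t)) unsplitK.
Qed.

Lemma future_concat (v : 'cV[R]_(\sum_(t < T) d))
    (w : 'cV[R]_(\sum_(t < N) d)) : future (concat v w) = w.
Proof.
by apply/mxcolP => t; rewrite !mxcolK -[rshift T t]/(unsplit (inr t)) unsplitK.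
Qed.

Lemma concat_past_future (v : 'cV[R]_(\sum_(t < T + N) d)) :
  concat (past v) (future v) = v.
Proof.
apply/mxcolP => t; rewrite mxcolK -{2}(splitK t).
by case: (split t) => i; rewrite mxcolK.
Qed.

End Stacking.

(** * Trajectories of an input-output system *)

Section Trajectories.
Variables (R : realType) (n m p : nat).
Variables (f : 'cV[R]_n -> 'cV[R]_m -> 'cV[R]_n).
Variables (g : 'cV[R]_n -> 'cV[R]_m -> 'cV[R]_p).

Lemma generated_from_exists L x0 (u : 'cV[R]_(\sum_(t < L) m)) :
  exists y, generated_from f g x0 u y.
Proof.
(* States are indexed by all of nat, so the input is continued by zero. *)
pose v t := if insub t is Some i then submxcol u (i : 'I_L) else 0.
pose x := fix x t := if t is s.+1 then f (x s) (v s) else x0.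
have vE (t : 'I_L) : v t = submxcol u t by rewrite /v valK.
exists (\mxcol_(t < L) g (x t) (submxcol u t)), x; split=> // t.
by rewrite mxcolK /= vE.
Qed.

Lemma generated_from_unique L x0 (u : 'cV[R]_(\sum_(t < L) m)) y y' :
  generated_from f g x0 u y -> generated_from f g x0 u y' -> y = y'.
Proof.
move=> [x [x_0 Hx]] [x' [x'_0 Hx']].
have eqx t : (t <= L)%N -> x t = x' t.
  elim: t => [|t IHt] ltL; first by rewrite x_0 x'_0.
  have [/= -> _] := Hx (Ordinal ltL); have [/= -> _] := Hx' (Ordinal ltL).
  by rewrite IHt // ltnW.
apply/mxcolP => t; have [_ ->] := Hx t; have [_ ->] := Hx' t.
by rewrite eqx // ltnW.
Qed.

Lemma generated_from_past T N x0 (u : 'cV[R]_(\sum_(t < T + N) m)) y :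
  generated_from f g x0 u y -> generated_from f g x0 (past u) (past y).
Proof.
move=> [x [x_0 Hx]]; exists x; split=> // t; rewrite !mxcolK.
exact: (Hx (lshift N t)).
Qed.

Lemma generated_from_window L k (x : nat -> 'cV[R]_n) u y : (L <= k)%N ->
    (forall t, (t < k)%N -> x t.+1 = f (x t) (u t) /\ y t = g (x t) (u t)) ->
  generated_from f g (x (k - L)%N) (\mxcol_(t < L) u (k - L + t)%N)
    (\mxcol_(t < L) y (k - L + t)%N).
Proof.
move=> leLk Hx; exists (fun t => x (k - L + t)%N); split=> [|t].
  by rewrite addn0.
by rewrite !mxcolK addnS; apply: Hx; rewrite -ltn_subRL subKn.
Qed.

End Trajectories.

(** * Linear systems *)

(** The hypothesis on C A^t e for t < n says that e is unobservable; modulo the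
    characteristic polynomial, of degree n, every power of A is a combination of
    the first n powers. *)
Lemma unobservable_iter (F : fieldType) n p (A : 'M[F]_n) (C : 'M[F]_(p, n))
    (e : 'cV[F]_n) :
    (forall t, (t < n)%N -> C *m iter t (mulmx A) e = 0) ->
  forall t, C *m iter t (mulmx A) e = 0.
Proof.
case: n => [|n] in A C e *; first by move=> _ t; rewrite [C]thinmx0 mul0mx.
have iterE t : iter t (mulmx A) e = horner_mx A 'X^t *m e.
  rewrite rmorphXn /= horner_mx_X.
  by elim: t => [|t IHt] /=; rewrite ?mul1mx // IHt mulmxA exprS.
move=> C0 t; rewrite iterE (divp_eq 'X^t (char_poly A)) rmorphD rmorphM /=.
rewrite Cayley_Hamilton mulr0 add0r.
set q := _ %% _.
have ltq : (size q <= n.+1)%N.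
  by rewrite -ltnS -(size_char_poly A) ltn_modp -size_poly_eq0 size_char_poly.
rewrite -[q]coefK poly_def linear_sum mulmx_suml mulmx_sumr big1 // => i _.
rewrite linearZ /= -scalemxAl -scalemxAr -iterE C0 ?scaler0 //.
exact: leq_trans (ltn_ord i) ltq.
Qed.

Section Linear.
Variables (R : realType) (nz m p : nat).
Variables (A : 'M[R]_nz) (B : 'M[R]_(nz, m)).
Variables (C : 'M[R]_(p, nz)) (D : 'M[R]_(p, m)).

Definition linear_next (z : 'cV[R]_nz) (u : 'cV[R]_m) := A *m z + B *m u.
Definition linear_output (z : 'cV[R]_nz) (u : 'cV[R]_m) := C *m z + D *m u.

Lemma linear_generated_columns L l (z0 : 'I_l -> 'cV[R]_nz)
    (u : 'I_l -> 'cV[R]_(\sum_(t < L) m))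
    (y : 'I_l -> 'cV[R]_(\sum_(t < L) p)) (a : 'cV[R]_l) :
    (forall i, generated_from linear_next linear_output (z0 i) (u i) (y i)) ->
  generated_from linear_next linear_output
    (columns z0 *m a) (columns u *m a) (columns y *m a).
Proof.
move=> /fin_all_exists[z Hz].
exists (fun t => columns (z^~ t) *m a); split=> [|t].
  by rewrite !columns_mul; apply: eq_bigr => i _; case: (Hz i) => ->.
rewrite /linear_next /linear_output !columns_mul !submxcol_sum !mulmx_sumr.
rewrite -!big_split; split; apply: eq_bigr => i _;
  have [_ /(_ t)[zS yE]] := Hz i.
  by rewrite zS submxcolZ scalerDr !scalemxAr.
by rewrite !submxcolZ yE scalerDr !scalemxAr.
Qed.

(** Two initial states that explain the same first nz outputs differ by an
    unobservable vector, so they cannot be told apart later either. *)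
Lemma linear_output_determined T N z0 z0' (u : 'cV[R]_(\sum_(t < T + N) m))
    y y' : (nz <= T)%N ->
    generated_from linear_next linear_output z0 u y ->
    generated_from linear_next linear_output z0' u y' ->
  past y = past y' -> y = y'.
Proof.
move=> le_nz_T [z [_ Hz]] [z' [_ Hz']] eq_past.
have diffE t : (t <= T + N)%N ->
    z t - z' t = iter t (mulmx A) (z 0%N - z' 0%N).
  elim: t => [|t IHt] ltL //=.
  have [/= -> _] := Hz (Ordinal ltL); have [/= -> _] := Hz' (Ordinal ltL).
  by rewrite -IHt 1?ltnW // /linear_next mulmxBr opprD addrACA subrr addr0.
have outE (t : 'I_(T + N)) : submxcol y t - submxcol y' t =
    C *m iter t (mulmx A) (z 0%N - z' 0%N).
  have [_ ->] := Hz t; have [_ ->] := Hz' t.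
  by rewrite -diffE 1?ltnW // /linear_output mulmxBr opprD addrACA subrr addr0.
apply/mxcolP => t; apply: subr0_eq; rewrite outE.
apply: unobservable_iter => s lt_s; have ltT := leq_trans lt_s le_nz_T.
move/mxcolP/(_ (Ordinal ltT)): eq_past; rewrite !mxcolK => eq_s.
by rewrite -(outE (lshift N (Ordinal ltT))) eq_s subrr.
Qed.

Lemma generated_from_lift n (f : 'cV[R]_n -> 'cV[R]_m -> 'cV[R]_n) g phi L x0
    (u : 'cV[R]_(\sum_(t < L) m)) y :
    koopman_embedding f g phi A B C D -> generated_from f g x0 u y ->
  generated_from linear_next linear_output (lift_map phi x0) u y.
Proof.
move=> [_ stateE outE] [x [x_0 Hx]].
exists (fun t => lift_map phi (x t)); split=> [|t]; first by rewrite x_0.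
by have [-> ->] := Hx t; rewrite stateE outE.
Qed.

End Linear.

(** * Data-driven representation *)

Theorem theorem3 (R : realType) (n m p nz l Tini N : nat)
    (f : 'cV[R]_n -> 'cV[R]_m -> 'cV[R]_n)
    (g : 'cV[R]_n -> 'cV[R]_m -> 'cV[R]_p)
    (phi : 'I_nz -> 'cV[R]_n -> R)
    (A : 'M[R]_nz) (B : 'M[R]_(nz, m)) (C : 'M[R]_(p, nz)) (D : 'M[R]_(p, m))
    (hK : koopman_embedding f g phi A B C D)
    (hT : (nz <= Tini)%N)
    (hl : (m * (Tini + N) + nz <= l)%N)
    (ud : 'I_l -> 'cV[R]_(\sum_(t < Tini + N) m))
    (yd : 'I_l -> 'cV[R]_(\sum_(t < Tini + N) p))
    (hd : forall i : 'I_l, behaviour f g (col_mx (ud i) (yd i)))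
    (x0 : 'I_l -> 'cV[R]_n)
    (hexc : lifted_excitation f g phi x0 ud yd)
    (k : nat) (hk : (Tini <= k)%N)
    (x : nat -> 'cV[R]_n) (u : nat -> 'cV[R]_m) (y : nat -> 'cV[R]_p)
    (hxuy : forall t : nat, (t < k)%N ->
       x t.+1 = f (x t) (u t) /\ y t = g (x t) (u t))
    (uini : 'cV[R]_(\sum_(t < Tini) m)) (yini : 'cV[R]_(\sum_(t < Tini) p))
    (huini : uini = \mxcol_(t < Tini) u (k - Tini + t)%N)
    (hyini : yini = \mxcol_(t < Tini) y (k - Tini + t)%N)
    (uF : 'cV[R]_(\sum_(t < N) m)) (yF : 'cV[R]_(\sum_(t < N) p)) :
  behaviour f g (col_mx (concat uini uF) (concat yini yF)) <->
  exists alpha : 'cV[R]_l,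
    col_mx (past (columns ud))
      (col_mx (past (columns yd))
        (col_mx (future (columns ud)) (future (columns yd)))) *m alpha
    = col_mx uini (col_mx yini (col_mx uF yF)).
Proof.
have [genD freeH] := hexc.
have genK alpha : generated_from (linear_next A B) (linear_output C D)
    (columns (fun i => lift_map phi (x0 i)) *m alpha)
    (columns ud *m alpha) (columns yd *m alpha).
  by apply: linear_generated_columns => i; apply: generated_from_lift (genD i).
split=> [[x' ] | [alpha]].
  rewrite col_mxKu col_mxKd => gen'.
  have /row_freeP[G HG] := freeH.
  pose alpha := G *m col_mx (concat uini uF) (lift_map phi x').
  have: col_mx (columns ud) (columns (fun i => lift_map phi (x0 i))) *m alpha
      = col_mx (concat uini uF) (lift_map phi x') by rewrite mulmxA HG mul1mx.
  rewrite mul_col_mx => /eq_col_mx[uE zE].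
  have yE : columns yd *m alpha = concat yini yF.
    have := genK alpha; rewrite uE zE => /generated_from_unique; apply.
    exact: generated_from_lift gen'.
  exists alpha; rewrite !mul_col_mx !past_mul !future_mul uE yE.
  by rewrite !past_concat !future_concat.
rewrite !mul_col_mx !past_mul !future_mul.
move=> /eq_col_mx[uP /eq_col_mx[yP /eq_col_mx[uFE yFE]]].
have uE : columns ud *m alpha = concat uini uF.
  by rewrite -(concat_past_future (_ *m _)) uP uFE.
have yE : columns yd *m alpha = concat yini yF.
  by rewrite -(concat_past_future (_ *m _)) yP yFE.
(* The combined lifted states need not be a lift, so the witness is the measured
   state at the start of the window. *)
exists (x (k - Tini)%N); rewrite col_mxKu col_mxKd.
have [y' gen'] := generated_from_exists f g (x (k - Tini)%N) (concat uini uF).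
suff <- : y' = concat yini yF by [].
have genlin := genK alpha; rewrite uE yE in genlin.
apply: linear_output_determined hT (generated_from_lift hK gen') genlin _.
have := generated_from_past gen'; rewrite !past_concat.
move=> /generated_from_unique; apply.
by rewrite huini hyini; apply: generated_from_window.
Qed.
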